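(* For every finite undirected graph $G=(V,E)$ and every threshold function $t:V\to\mathbb{N}$, every execution of the algorithm MTS on input $(G,t)$ outputs a target set $S$ with $$|S|\le\sum_{v\in V}\min\left(1,\frac{t(v)}{d(v)+1}\right),$$ where $d(v)$ is the degree of $v$ in $G$.
   Context: Graphs are finite, without loops. An undirected graph is treated as the bidirected digraph in which each edge $\{u,v\}$ is replaced by the two arcs $(u,v),(v,u)$. For a digraph $G=(V,E)$ and $v\in V$, $\Gamma^{in}(v)=\{u:(u,v)\in E\}$ and $\Gamma^{out}(v)=\{u:(v,u)\in E\}$. Given thresholds $t:V\to\mathbb{N}=\{0,1,2,\dots\}$ and $S\subseteq V$, the activation process starting at $S$ is $A_0=S$ and $A_\ell=A_{\ell-1}\cup\{u\in V: |\Gamma^{in}(u)\cap A_{\ell-1}|\ge t(u)\}$ for $\ell\ge1$. $S$ is a target set for $(G,t)$ if $A_\lambda=V$ for some $\lambda\ge0$. Algorithm MTS on input $(G,t)$: set $S=\emptyset$, $L=\emptyset$, $U=V$, and for each $v\in V$ set $k(v)=t(v)$, $\delta(v)=|\Gamma^{in}(v)|$. While $U\neq\emptyset$, perform one iteration as follows. Case 1: if some $v\in U$ has $k(v)=0$, select such a $v$; for each $u\in\Gamma^{out}(v)\cap U$ set $k(u)=\max(k(u)-1,0)$ and, if $v\notin L$, set $\delta(u)=\delta(u)-1$; then set $U=U\setminus\{v\}$. Case 2: otherwise, if some $v\in U\setminus L$ has $\delta(v)<k(v)$, select such a $v$; set $S=S\cup\{v\}$; for each $u\in\Gamma^{out}(v)\cap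 U$ set $k(u)=k(u)-1$ and $\delta(u)=\delta(u)-1$; then set $U=U\setminus\{v\}$. Case 3: otherwise, select $v\in U\setminus L$ maximizing $\frac{k(u)}{\delta(u)(\delta(u)+1)}$ over $u\in U\setminus L$; for each $u\in\Gamma^{out}(v)\cap U$ set $\delta(u)=\delta(u)-1$; set $L=L\cup\{v\}$. When $U=\emptyset$, return $S$. Whenever several nodes qualify in a case, one of them is chosen arbitrarily. *)

(* Defs.v *)
From HB Require Import structures.
From mathcomp Require Import all_boot all_order all_algebra.
From Stdlib Require Import Relation_Operators.
Set Implicit Arguments.
Unset Strict Implicit.
Unset Printing Implicit Defensive.
Import Order.TTheory GRing.Theory Num.Theory.
Local Open Scope ring_scope.

(* A digraph on V is its arc relation [e : rel V]; an undirected graph is the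
   bidirected digraph, i.e. a symmetric (and irreflexive, no loops) relation. *)

Definition nbr_in (V : finType) (e : rel V) (v : V) : {set V} := [set u | e u v].
Definition nbr_out (V : finType) (e : rel V) (v : V) : {set V} := [set u | e v u].

Definition is_undirected (V : finType) (e : rel V) : Prop :=
  symmetric e /\ irreflexive e.

(* Meant for undirected graphs, where in- and out-neighbours coincide. *)
Definition degree (V : finType) (e : rel V) (v : V) : nat := #|nbr_out e v|.

Fixpoint activation (V : finType) (e : rel V) (t : V -> nat) (S : {set V})
    (l : nat) : {set V} :=
  if l is l'.+1 then
    let A := activation e t S l' in
    A :|: [set u | (t u <= #|nbr_in e u :&: A|)%N]
  else S.

Definition is_target_set (V : finType) (e : rel V) (t : V -> nat)
    (S : {set V}) : Prop :=
  exists l : nat, activation e t S l = [set: V].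

(* The counters k and delta are integers, so that "- 1" is never truncated. *)
Record mts_state (V : finType) := MtsState {
  st_S : {set V};
  st_L : {set V};
  st_U : {set V};
  st_k : V -> int;
  st_delta : V -> int
}.

Definition mts_init (V : finType) (e : rel V) (t : V -> nat) : mts_state V :=
  {| st_S := set0; st_L := set0; st_U := [set: V];
     st_k := fun v => (t v)%:Z;
     st_delta := fun v => #|nbr_in e v|%:Z |}.

Definition case1_node (V : finType) (s : mts_state V) (v : V) : bool :=
  (v \in st_U s) && (st_k s v == 0).

Definition case2_node (V : finType) (s : mts_state V) (v : V) : bool :=
  (v \in st_U s :\: st_L s) && (st_delta s v < st_k s v).

Definition mts_ratio (V : finType) (s : mts_state V) (u : V) : rat :=
  (st_k s u)%:~R / ((st_delta s u)%:~R * ((st_delta s u)%:~R + 1)).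

Definition case3_node (V : finType) (s : mts_state V) (v : V) : Prop :=
  v \in st_U s :\: st_L s /\
  forall u, u \in st_U s :\: st_L s -> mts_ratio s u <= mts_ratio s v.

Definition mts_update1 (V : finType) (e : rel V) (s : mts_state V) (v : V) :=
  {| st_S := st_S s; st_L := st_L s; st_U := st_U s :\ v;
     st_k := fun u => if u \in nbr_out e v :&: st_U s
                      then Num.max (st_k s u - 1) 0 else st_k s u;
     st_delta := fun u => if (u \in nbr_out e v :&: st_U s) && (v \notin st_L s)
                          then st_delta s u - 1 else st_delta s u |}.

Definition mts_update2 (V : finType) (e : rel V) (s : mts_state V) (v : V) :=
  {| st_S := v |: st_S s; st_L := st_L s; st_U := st_U s :\ v;
     st_k := fun u => if u \in nbr_out e v :&: st_U s
                      then st_k s u - 1 else st_k s u;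
     st_delta := fun u => if u \in nbr_out e v :&: st_U s
                          then st_delta s u - 1 else st_delta s u |}.

Definition mts_update3 (V : finType) (e : rel V) (s : mts_state V) (v : V) :=
  {| st_S := st_S s; st_L := v |: st_L s; st_U := st_U s;
     st_k := st_k s;
     st_delta := fun u => if u \in nbr_out e v :&: st_U s
                          then st_delta s u - 1 else st_delta s u |}.

(* One iteration of the while loop; its guard U <> set0 is implied by the
   membership of the selected node in U. *)
Inductive mts_step (V : finType) (e : rel V) (s : mts_state V) :
    mts_state V -> Prop :=
| MtsCase1 v of case1_node s v : mts_step e s (mts_update1 e s v)
| MtsCase2 v of (forall u, ~~ case1_node s u) & case2_node s v :
    mts_step e s (mts_update2 e s v)
| MtsCase3 v of (forall u, ~~ case1_node s u) & (forall u, ~~ case2_node s u)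
    & case3_node s v : mts_step e s (mts_update3 e s v).

Definition mts_reachable (V : finType) (e : rel V) (t : V -> nat)
    (s : mts_state V) : Prop :=
  clos_refl_trans _ (mts_step e) (mts_init e t) s.

(* Every execution reaches the return statement: there is no infinite
   execution, and none gets stuck while U is nonempty. *)
Definition mts_always_returns (V : finType) (e : rel V) (t : V -> nat) : Prop :=
  Acc (fun s' s => mts_step e s s') (mts_init e t) /\
  forall s, mts_reachable e t s -> st_U s <> set0 -> exists s', mts_step e s s'.

Definition mts_output (V : finType) (e : rel V) (t : V -> nat)
    (S : {set V}) : Prop :=
  exists s, [/\ mts_reachable e t s, st_U s = set0 & st_S s = S].

(* Main.v *)
Require Import Defs.
From mathcomp Require Import all_boot all_order all_algebra.
From mathcomp Require Import zify ring lra.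
From Stdlib Require Import Relation_Operators Operators_Properties.
Set Implicit Arguments.
Unset Strict Implicit.
Unset Printing Implicit Defensive.
Import Order.TTheory GRing.Theory Num.Theory.
Local Open Scope ring_scope.

(** Give each node of U \ L the charge min(1, k / (delta + 1)).  The size of S
    plus the total charge never increases: deleting a node lowers both counters
    of its neighbours, which lowers their charges; a node entering S pays with
    its own charge, which is 1; and when v enters L, each of its delta(v)
    neighbours in U \ L gains at most the maximal ratio
    k(v) / (delta(v) (delta(v) + 1)), in total at most the charge that v gives
    up.  S is a target set since the deleted nodes are always activated by S.
    The algorithm cannot get stuck with U included in L: when the last node of U
    to enter L did so, its threshold k was at most its number delta of
    neighbours in U \ L, and all of these have been deleted since. *)

(** * Counting neighbours, and monotonicity of activation *)

Lemma cardsID1 (T : finType) (N A : {set T}) (v : T) :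
  v \in A -> #|N :&: A| = ((v \in N) + #|N :&: (A :\ v)|)%N.
Proof. by move=> vA; rewrite (cardsD1 v (N :&: A)) inE vA andbT setIDA. Qed.

Lemma cardsDD1 (T : finType) (N A : {set T}) (v : T) :
  v \in A -> #|N :\: (A :\ v)| = ((v \in N) + #|N :\: A|)%N.
Proof.
move=> vA; rewrite (cardsD1 v (N :\: (A :\ v))) !inE eqxx /=.
congr (_ + #|pred_of_set _|)%N; apply/setP=> x; rewrite !inE.
by case: (eqVneq x v) => [->|_] //=; rewrite vA.
Qed.

Lemma activation_subset (V : finType) (e : rel V) (t : V -> nat)
    (S S' : {set V}) (l : nat) :
  S \subset S' -> activation e t S l \subset activation e t S' l.
Proof.
move=> sSS'; elim: l => [|l IHl] //=; apply: setUSS => //.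
apply/subsetP=> u; rewrite !inE => /leq_trans; apply.
by apply: subset_leq_card; apply: setIS.
Qed.

Lemma subset_activation (V : finType) (e : rel V) (t : V -> nat)
    (S : {set V}) (l : nat) : S \subset activation e t S l.
Proof. by elim: l => [|l IHl] //=; rewrite subsetU // IHl. Qed.

(** * How the charge reacts to a change of the counters *)

Definition charge (k d : int) : rat := Num.min 1 (k%:~R / (d%:~R + 1)).

Lemma charge_ge0 (k d : int) : 0 <= k -> 0 <= d -> 0 <= charge k d.
Proof.
move=> k0 d0; rewrite le_min ler01 divr_ge0 ?ler0z //.
by rewrite addr_ge0 ?ler0z.
Qed.

Lemma charge_le (k k' d : int) : 0 <= d -> k <= k' -> charge k d <= charge k' d.
Proof.
move=> d0 kk'; rewrite le_min !ge_min lexx /=; apply/orP; right.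
by rewrite ler_wpM2r ?ler_int // invr_ge0 addr_ge0 ?ler0z.
Qed.

(** For [1 <= k <= d], the inequality [(k - 1) / d <= k / (d + 1)] amounts to [k <= d + 1]; for
    [k > d] the right-hand charge is already capped at 1. Truncation matters only for [k = 0], where
    both charges vanish. *)
Lemma charge_decr (k d : int) :
  0 <= k -> 1 <= d -> charge (Num.max (k - 1) 0) (d - 1) <= charge k d.
Proof.
move=> k0 d1; have d0 : 0 < (d%:~R : rat) by rewrite ltr0z; lia.
have [k1|k1] := leP 1 k; last first.
  have ->: k = 0 by lia.
  by rewrite /charge /= !mul0r.
have -> : Num.max (k - 1) 0 = k - 1 by lia.
rewrite /charge intrB intrD subrK.
have [dk|dk] := ltP d k.
  have le1 : 1 <= (k%:~R : rat) / (d%:~R + 1).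
    rewrite ler_pdivlMr ?ltr_wpDl ?ler0z //; last by lia.
    by rewrite mul1r -(intrD _ d 1) ler_int; lia.
  by rewrite (min_l le1) ge_min lexx.
rewrite le_min !ge_min lexx /=; apply/orP; right.
rewrite ler_pdivrMr // mulrAC ler_pdivlMr; last by lra.
have : (k%:~R : rat) <= d%:~R by rewrite ler_int.
by lra.
Qed.

(** Exactly, [k / d = k / (d + 1) + k / (d * (d + 1))], and [k <= d] keeps the cap at 1 inactive on
    the right. *)
Lemma charge_decr_delta (k d : int) :
  0 <= k -> k <= d -> 1 <= d ->
  charge k (d - 1) <= charge k d + k%:~R / (d%:~R * (d%:~R + 1)).
Proof.
move=> k0 kd d1; have d0 : 0 < (d%:~R : rat) by rewrite ltr0z; lia.
have kd' : (k%:~R : rat) <= d%:~R by rewrite ler_int.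
rewrite /charge intrB subrK ge_min; apply/orP; right.
rewrite min_r; last by rewrite ler_pdivrMr; lra.
rewrite le_eqVlt; apply/orP; left; apply/eqP; field.
by rewrite !lt0r_neq0 //; lra.
Qed.

(** * The potential and the loop invariant *)

Definition potential (V : finType) (s : mts_state V) : rat :=
  \sum_(u in st_U s :\: st_L s) charge (st_k s u) (st_delta s u).

(** [inv_t_le] is only an inequality because Case 1 truncates k at 0. Read at [k = 0], it says that
    enough neighbours have been deleted to activate the node. *)
Record mts_inv (V : finType) (e : rel V) (t : V -> nat) (s : mts_state V) :
  Prop := MtsInv {
    inv_k_ge0 : forall u, u \in st_U s -> 0 <= st_k s u;
    inv_t_le : forall u, u \in st_U s ->
      (t u)%:Z <= st_k s u + #|nbr_in e u :\: st_U s|%:Z;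
    inv_delta : forall u, u \in st_U s ->
      st_delta s u = #|nbr_in e u :&: (st_U s :\: st_L s)|%:Z;
    (* The choice of u in X replaces "the last node of X to enter L", so that
       the order of insertion need not be recorded. *)
    inv_wait : forall X : {set V}, X \subset st_U s :&: st_L s -> X != set0 ->
      exists2 u, u \in X & st_k s u <= #|nbr_in e u :&: (st_U s :\: X)|%:Z;
    inv_active : exists l, ~: st_U s \subset activation e t (st_S s) l;
    inv_bound : #|st_S s|%:R + potential s <=
      \sum_(v : V) Num.min 1 ((t v)%:R / ((degree e v)%:R + 1)) }.

(* The common effect of Cases 1 and 2, except on S. *)
Record deletion (V : finType) (e : rel V) (s : mts_state V) (v : V)
    (s' : mts_state V) : Prop := Deletion {
  del_U : st_U s' = st_U s :\ v;
  del_L : st_L s' = st_L s;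
  del_k : forall u, u \in st_U s ->
    st_k s' u = if e v u then Num.max (st_k s u - 1) 0 else st_k s u;
  del_delta : forall u, u \in st_U s ->
    st_delta s' u = if e v u && (v \notin st_L s) then st_delta s u - 1
                    else st_delta s u }.

Lemma deletion_update1 (V : finType) (e : rel V) (s : mts_state V) (v : V) :
  deletion e s v (mts_update1 e s v).
Proof. by split=> //= u uU; rewrite !inE uU andbT. Qed.

(** Case 2 neither truncates k nor tests membership in L; positive thresholds make the truncation
    invisible, and [v \notin st_L s] makes the test succeed. *)
Lemma deletion_update2 (V : finType) (e : rel V) (s : mts_state V) (v : V) :
  v \notin st_L s -> (forall u, u \in st_U s -> 1 <= st_k s u) ->
  deletion e s v (mts_update2 e s v).
Proof.
move=> vL kpos; split=> //= u uU; rewrite !inE uU ?vL !andbT //.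
by case: ifP => // _; have := kpos u uU; lia.
Qed.

(** * Every iteration preserves the invariant, and none gets stuck *)

Section Invariant.

Context {V : finType} {e : rel V} {t : V -> nat}.

Lemma init_inv : is_undirected e -> mts_inv e t (mts_init e t).
Proof.
move=> [esym _]; split=> //=.
- by move=> u _; lia.
- by move=> u _; rewrite setD0 setIT.
- by move=> X; rewrite setI0 subset0 => /eqP->; rewrite eqxx.
- by exists 0%N; rewrite setCT sub0set.
(* The initial potential equals the bound: by symmetry the in-degree stored in delta is the
   degree. *)
rewrite cards0 add0r /potential /= setD0 le_eqVlt; apply/orP; left; apply/eqP.
apply: eq_big => [v|v _]; first by rewrite inE.
rewrite /charge /degree !pmulrn; congr (Num.min 1 (_ / (_%:~R + 1))).
by congr (Posz #|pred_of_set _|); apply/setP=> u; rewrite !inE esym.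
Qed.

Lemma deletion_charge s v s' u :
  mts_inv e t s -> deletion e s v s' -> v \in st_U s ->
  u \in (st_U s :\: st_L s) :\ v ->
  charge (st_k s' u) (st_delta s' u) <= charge (st_k s u) (st_delta s u).
Proof.
move=> I D vU; rewrite !inE => /and3P[uv uL uU].
rewrite (del_k D) // (del_delta D) //; have k0 := inv_k_ge0 I uU.
have dE := inv_delta I uU.
case: (boolP (e v u)) => //= evu; case: (boolP (v \in st_L s)) => /= vL.
  by apply: charge_le; rewrite ?dE //; lia.
(* [delta(u)] is at least 1, since it still counts [v]. *)
apply: charge_decr => //; rewrite dE lez_nat card_gt0; apply/set0Pn.
by exists v; rewrite !inE evu vL vU.
Qed.

Lemma deletion_potential s v s' :
  mts_inv e t s -> deletion e s v s' -> v \in st_U s ->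
  potential s' <=
    \sum_(u in (st_U s :\: st_L s) :\ v) charge (st_k s u) (st_delta s u).
Proof.
move=> I D vU; rewrite /potential (del_U D) (del_L D).
rewrite (_ : _ :\: _ = (st_U s :\: st_L s) :\ v); last first.
  by apply/setP=> u; rewrite !inE andbCA.
by apply: ler_sum => u; apply: deletion_charge I D vU.
Qed.

Lemma deletion_inv s v s' :
  mts_inv e t s -> deletion e s v s' -> v \in st_U s ->
  (exists l, ~: st_U s' \subset activation e t (st_S s') l) ->
  #|st_S s'|%:R + potential s' <= #|st_S s|%:R + potential s ->
  mts_inv e t s'.
Proof.
move=> I D vU act bnd; have [U'E L'E k'E d'E] := D.
have U'U u : u \in st_U s' -> u \in st_U s by rewrite U'E !inE => /andP[].
split=> //.
- move=> u /U'U uU; rewrite k'E //; have := inv_k_ge0 I uU.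
  by case: ifP => _; lia.
- move=> u /U'U uU; rewrite k'E // U'E cardsDD1 // inE.
  by have := inv_t_le I uU; case: (e v u); lia.
- move=> u /U'U uU; rewrite d'E // U'E L'E (inv_delta I) //.
  have -> : st_U s :\ v :\: st_L s = (st_U s :\: st_L s) :\ v.
    by apply/setP=> x; rewrite !inE andbCA.
  case: (boolP (v \in st_L s)) => vL /=.
    rewrite andbF; congr (Posz #|pred_of_set (_ :&: _)|).
    by apply/setP=> x; rewrite !inE; case: (eqVneq x v) => // ->; rewrite vL.
  rewrite (@cardsID1 _ _ (st_U s :\: st_L s) v) ?inE ?vL //.
  by case: (e v u); rewrite /=; lia.
- move=> X; rewrite U'E L'E => sX X0.
  have sX' : X \subset st_U s :&: st_L s.
    by apply: subset_trans sX _; apply: setSI; apply: subsetDl.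
  have vX : v \notin X.
    by apply/negP=> /(subsetP sX); rewrite !inE eqxx.
  have [u uX ku] := inv_wait I sX' X0; exists u => //.
  have uU : u \in st_U s by move/(subsetP sX'): uX; rewrite inE => /andP[].
  (* The same [u] still works: if [v] is a neighbour of [u], it lay in [U \ X], so the count drops
     by one along with k. *)
  rewrite k'E //; move: ku.
  rewrite (@cardsID1 _ _ (st_U s :\: X) v) ?inE ?vX //.
  have -> : st_U s :\ v :\: X = (st_U s :\: X) :\ v.
    by apply/setP=> x; rewrite !inE andbCA.
  by case: (e v u); rewrite /=; lia.
exact: le_trans bnd (inv_bound I).
Qed.

Lemma update1_inv s v :
  mts_inv e t s -> case1_node s v -> mts_inv e t (mts_update1 e s v).
Proof.
move=> I /andP[vU /eqP kv]; have D := deletion_update1 e s v.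
apply: (deletion_inv I D vU); rewrite /=.
  have [l sl] := inv_active I; exists l.+1 => /=; apply/subsetP=> u.
  rewrite !inE negb_and negbK => /orP[/eqP->|uU]; last first.
    by rewrite (subsetP sl) // inE.
  (* With [k(v) = 0], at least [t(v)] neighbours are deleted, hence active by round [l], so [v] is
     active one round later. *)
  apply/orP; right; have := inv_t_le I vU.
  rewrite kv add0r lez_nat => /leq_trans; apply.
  by rewrite setDE; apply: subset_leq_card; apply: setIS.
rewrite lerD2l; apply: le_trans (deletion_potential I D vU) _.
rewrite /potential; case: (boolP (v \in st_U s :\: st_L s)) => vUL.
  rewrite [leRHS](big_setD1 v) //= lerDr charge_ge0 ?kv //.
  by rewrite (inv_delta I).
rewrite (_ : _ :\ v = st_U s :\: st_L s) //.
by apply/setDidPl; rewrite disjoint_sym disjoints1.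
Qed.

Lemma no_case1_k_ge1 s : mts_inv e t s -> (forall u, ~~ case1_node s u) ->
  forall u, u \in st_U s -> 1 <= st_k s u.
Proof.
move=> I no1 u uU; have := inv_k_ge0 I uU; have := no1 u.
by rewrite /case1_node uU /=; lia.
Qed.

Lemma update2_inv s v :
  mts_inv e t s -> (forall u, ~~ case1_node s u) -> case2_node s v ->
  mts_inv e t (mts_update2 e s v).
Proof.
move=> I no1 /andP[vUL dk]; have /setDP[vU vL] := vUL.
have D := deletion_update2 e vL (no_case1_k_ge1 I no1).
apply: (deletion_inv I D vU); rewrite /=.
  have [l sl] := inv_active I; exists l; apply/subsetP=> u.
  rewrite !inE negb_and negbK => /orP[/eqP->|uU].
    by rewrite (subsetP (subset_activation _ _ _ _)) // setU11.
  apply: (subsetP (activation_subset e t l (subsetUr [set v] (st_S s)))).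
  by rewrite (subsetP sl) // inE.
apply: le_trans (_ : #|st_S s|%:R + (1 +
  \sum_(u in (st_U s :\: st_L s) :\ v) charge (st_k s u) (st_delta s u)) <= _).
  rewrite addrA lerD ?deletion_potential //.
  by rewrite natr1 ler_nat cardsU1; case: (v \notin _).
rewrite lerD2l /potential [leRHS](big_setD1 v) //= lerD2r.
(* The integers satisfy [delta + 1 <= k], so [v] releases a full unit, which pays for its entry into
   S. *)
rewrite /charge le_min lexx /=.
have d0 : 0 <= st_delta s v by rewrite (inv_delta I).
rewrite ler_pdivlMr; last by rewrite ltr_wpDl ?ler0z.
by rewrite mul1r -(intrD _ _ 1) ler_int; lia.
Qed.

Lemma update3_potential s v :
  is_undirected e -> mts_inv e t s -> (forall u, ~~ case1_node s u) ->
  (forall u, ~~ case2_node s u) -> case3_node s v ->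
  potential (mts_update3 e s v) <= potential s.
Proof.
move=> [esym eirr] I no1 no2 [vUL vmax]; have /setDP[vU vL] := vUL.
set W := st_U s :\: st_L s in vUL vmax.
have kd u : u \in W -> 1 <= st_k s u /\ st_k s u <= st_delta s u.
  move=> uW; have /setDP[uU uL] := uW; split; first exact: no_case1_k_ge1.
  by have := no2 u; rewrite /case2_node uW /= -leNgt.
have [kv dv] := kd v vUL.
have d0 : 0 < ((st_delta s v)%:~R : rat) by rewrite ltr0z; lia.
rewrite /potential /= (_ : _ :\: _ = W :\ v); last first.
  by apply/setP=> u; rewrite !inE negb_or andbA.
rewrite [leRHS](big_setD1 v) //= -/W.
(* Each neighbour of [v] in [W] gains at most its own ratio, hence at most that of [v]. *)
apply: le_trans (_ : \sum_(u in W :\ v) (charge (st_k s u) (st_delta s u)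
    + if e v u then mts_ratio s v else 0) <= _).
  apply: ler_sum => u /setD1P[_ uW]; have [ku du] := kd u uW.
  have /setDP[uU uL] := uW; rewrite !inE uU andbT.
  case: ifP => _; last by rewrite addr0.
  apply: le_trans (charge_decr_delta _ _ _) _ => //; try lia.
  by rewrite lerD2l; apply: vmax.
rewrite big_split /= addrC lerD2r -big_mkcondr sumr_const.
(* Symmetry turns the affected out-neighbours into the in-neighbours counted by [delta(v)]; without
   loops, removing [v] from [W] loses none of them. *)
have -> : #|[pred u in W :\ v | e v u]| = #|nbr_in e v :&: W|.
  apply: eq_card => u; rewrite !inE [e u v]esym.
  by case: (eqVneq u v) => [->|_] /=; rewrite ?eirr // andbC.
have dE := inv_delta I vU; rewrite -/W in dE.
rewrite -mulr_natr pmulrn -dE /mts_ratio /charge min_r; last first.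
  rewrite ler_pdivrMr ?mul1r; last by lra.
  by rewrite -(intrD _ _ 1) ler_int; lia.
rewrite le_eqVlt; apply/orP; left; apply/eqP; field.
by rewrite !lt0r_neq0 //; lra.
Qed.

Lemma update3_inv s v :
  is_undirected e -> mts_inv e t s -> (forall u, ~~ case1_node s u) ->
  (forall u, ~~ case2_node s u) -> case3_node s v ->
  mts_inv e t (mts_update3 e s v).
Proof.
move=> und I no1 no2 c3; have [vUL _] := c3; have /setDP[vU vL] := vUL.
have bnd := update3_potential und I no1 no2 c3; have [esym eirr] := und.
split=> //=.
- exact: inv_k_ge0 I.
- exact: inv_t_le I.
- move=> u uU; rewrite !inE uU andbT.
  have -> : st_U s :\: (v |: st_L s) = (st_U s :\: st_L s) :\ v.
    by apply/setP=> x; rewrite !inE negb_or andbA.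
  rewrite (inv_delta I) // (@cardsID1 _ _ _ v vUL) inE.
  by case: (e v u); lia.
- move=> X sX X0; case: (boolP (v \in X)) => vX; last first.
    apply: (inv_wait I) => //; apply/subsetP=> x xX.
    have := subsetP sX x xX; rewrite !inE => /andP[-> /orP[/eqP xv|->]] //.
    by rewrite -xv xX in vX.
  (* Take the newest node of L as witness. Case 2 fails, so [k(v) <= delta(v)], and the neighbours
     counted by [delta(v)] avoid X, which lies in L together with [v]. *)
  exists v => //; have := no2 v; rewrite /case2_node vUL /= -leNgt.
  rewrite (inv_delta I) // => /le_trans; apply; rewrite lez_nat.
  apply/subset_leq_card/subsetP=> x; rewrite !inE => /and3P[exv xL ->].
  rewrite exv andbT /=; apply/negP=> /(subsetP sX).
  rewrite !inE (negbTE xL) orbF => /andP[_ /eqP xv].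
  by rewrite xv eirr in exv.
- exact: inv_active I.
by apply: le_trans (inv_bound I); rewrite lerD2l.
Qed.

Lemma step_inv s s' :
  is_undirected e -> mts_inv e t s -> mts_step e s s' -> mts_inv e t s'.
Proof.
move=> und I [v c1|v no1 c2|v no1 no2 c3].
- exact: update1_inv.
- exact: update2_inv.
- exact: update3_inv.
Qed.

Lemma reachable_inv s :
  is_undirected e -> mts_reachable e t s -> mts_inv e t s.
Proof.
move=> und run; elim: (clos_rt_rtn1 _ _ _ _ run) => [|s1 s2 st _ IH].
  exact: init_inv.
exact: step_inv st.
Qed.

Lemma inv_progress s :
  mts_inv e t s -> st_U s <> set0 -> exists s', mts_step e s s'.
Proof.
move=> I /eqP U0.
have [/existsP[v c1]|/existsPn no1] := boolP [exists v, case1_node s v].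
  by exists (mts_update1 e s v); apply: MtsCase1.
have [/existsP[v c2]|/existsPn no2] := boolP [exists v, case2_node s v].
  by exists (mts_update2 e s v); apply: MtsCase2.
have [UL0|[v0 v0W]] := set_0Vmem (st_U s :\: st_L s).
  (* If U is included in L, then [inv_wait] with [X = U] leaves no neighbour to count, so some k is
     at most 0 although Case 1 fails. *)
  have sUL : st_U s \subset st_U s :&: st_L s.
    by rewrite subsetI subxx -setD_eq0 UL0 eqxx.
  have [u uU] := inv_wait I sUL U0; rewrite setDv setI0 cards0 => k0.
  by have := no_case1_k_ge1 I no1 uU; lia.
have [v vW vmax] := Order.TotalTheory.arg_maxP (mts_ratio s) v0W.
by exists (mts_update3 e s v); apply: MtsCase3.
Qed.

End Invariant.

(** * Termination and conclusion *)

Lemma step_measure (V : finType) (e : rel V) (s s' : mts_state V) :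
  mts_step e s s' ->
  (#|st_U s'| + #|~: st_L s'| < #|st_U s| + #|~: st_L s|)%N.
Proof.
(* Cases 1 and 2 remove a node from U; Case 3 removes one from the complement of L. *)
case=> [v /andP[vU _]|v _ /andP[/setDP[vU _] _]|v _ _ [/setDP[_ vL] _]] /=.
- by rewrite (cardsD1 v (st_U s)) vU; lia.
- by rewrite (cardsD1 v (st_U s)) vU; lia.
rewrite (cardsD1 v (~: st_L s)) inE vL setCU setIC -setDE.
by rewrite addnCA ltnS.
Qed.

Lemma step_Acc (V : finType) (e : rel V) (s : mts_state V) :
  Acc (fun s2 s1 => mts_step e s1 s2) s.
Proof.
have [n] := ubnP (#|st_U s| + #|~: st_L s|)%N.
elim: n s => [|n IHn] s; first by rewrite ltn0.
rewrite ltnS => le_s.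
constructor=> s' /step_measure lt_s'; apply: IHn.
exact: leq_trans lt_s' le_s.
Qed.

Theorem theorem5 (V : finType) (e : rel V) (t : V -> nat)
    (he : is_undirected e) :
  mts_always_returns e t /\
  forall S : {set V}, mts_output e t S ->
    is_target_set e t S /\
    (#|S|%:R : rat) <=
      \sum_(v : V) Num.min 1 ((t v)%:R / ((degree e v)%:R + 1)).
Proof.
split.
  split; first exact: step_Acc.
  by move=> s /(reachable_inv he)/inv_progress.
move=> S [s [/(reachable_inv he) I U0 <-]]; split.
  have [l] := inv_active I; rewrite U0 setC0 subTset => /eqP actT.
  by exists l.
have := inv_bound I; rewrite /potential U0 set0D big_set0.
by rewrite addr0.
Qed.
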